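(* Let $L>0$, $N\ge1$, $B\succ0$, and $x_0\in\mathbb{R}^d$. Consider any oracle $O\in\mathcal{O}_L$ and let $\{(x_i,f_i,g_i,\tau_i,z_{i+1})\}_{i=0}^N$ denote the results of running BSPGM with $L_0=L$ against $O$, where $O$ finally reveals $(x_\star,f_\star,0)$. Then $$\frac{f_N-f_\star}{\frac L2\|x_0-x_\star\|_B^2}\le\frac1{\tau_{N,N}}\le\frac1{\tau_{N-1,N}}\le\dots\le\frac1{\tau_{1,N}}\le\frac1{\tau_{0,N}}=\frac{2}{N(N+1)+\sqrt{2N(N+1)}},$$ where, for $0\le n\le N$, $\tau_{n,n}=\tau_n$ and, for $n<i\le N$, $$\tau_{n,i}=\tau_{n,i-1}+\frac{1+\sqrt{1+8\tau_{n,i-1}}}{2}\ \ (i<N),\qquad \tau_{n,N}=\tau_{n,N-1}+\sqrt{\tau_{n,N-1}} .$$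
   Context: **Notation.** For symmetric positive definite $B$: $\langle x,y\rangle_B=\langle x,B^{-1}y\rangle$, $\|x\|_B=\sqrt{\langle x,x\rangle_B}$. For data $(x_i,f_i,g_i)$ put $$W_{i,j}=f_i-f_j-\langle g_j,x_i-x_j\rangle_B,\qquad Q_{i,j}(L)=f_i-f_j-\langle g_j,x_i-x_j\rangle_B-\frac1{2L}\|g_i-g_j\|_B^2 .$$ **Oracles.** A first-order oracle is a mapping $O:\{(x_i,f_i,g_i)\}_{i=0}^{n-1}\times\{x_n\}\mapsto(f_n,g_n)\in\mathbb{R}\times\mathbb{R}^d$ sending each possible $n$th iterate (given the past) to a response, together with a final response $O:\{(x_i,f_i,g_i)\}_{i=0}^N\mapsto(x_\star,f_\star,g_\star)$ with $g_\star=0$. The responses need not come from an actual function. $\mathcal{O}_L$ is the set of all oracles for which $Q_{i,j}(L)\ge0$ for every $i<j$ and $W_{\star,i}\ge0$ for every $i$ always hold. **BSPGM with $L_0=L$ against an oracle in $\mathcal{O}_L$.** (For such oracles the null-step test of BSPGM, which triggers when $Q_{m,n}(L)<0$, never triggers, so the smoothness estimate stays equal to $L$, and the algorithm reads as follows.) The memory size is $k\in\mathbb{N}$. Initialize $\tau_0=1$, $z_1=x_0-\frac1Lg_0$. For $n=1,\dots,N$: let $I_n=\{\max(0,n-k),\dots,n-1\}$, $v_i=f_i-\frac1{2L}\|g_i\|_B^2$, $m\in\arg\min_{i\in I_n}v_i$, and for $i\in I_n$ $$a_i=\tau_i(v_i-v_m)+\frac L2\|z_{i+1}-x_0\|_B^2,\qquad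 b_i=f_i-\langle g_i,x_i-x_0\rangle_B-v_m .$$ Let $Z$ have columns $z_{i+1}-x_0$ and $G$ have columns $\frac{g_i}L$, $i\in I_n$. Solve $$\max_{\rho,\gamma\in\mathbb{R}^{I_n}}\ \sum_i\rho_i\tau_i+\sum_i\gamma_i\quad\text{s.t.}\quad\sum_i\rho_ia_i+\sum_i\gamma_ib_i-\frac L2\|Z\rho-G\gamma\|_B^2\ge0,\ \rho,\gamma\ge0 .$$ If it is unbounded BSPGM stops early, returning $x_m-\frac1Lg_m$ (then $\tau_n$ is not generated). Otherwise, with an optimal $(\rho,\gamma)$, set $\tau'=\sum_i\rho_i\tau_i+\sum_i\gamma_i$ and $z'=x_0+Z\rho-G\gamma$; set $\tau_n=\tau'+\frac{1+\sqrt{1+8\tau'}}2$ if $n<N$ and $\tau_n=\tau'+\sqrt{\tau'}$ if $n=N$; set $x_n=\frac{\tau'}{\tau_n}\left(x_m-\frac1Lg_m\right)+\frac{\tau_n-\tau'}{\tau_n}z'$, query the oracle for $(f_n,g_n)$, and set $z_{n+1}=z'-\frac{\tau_n-\tau'}Lg_n$. *)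

(* Defs.v *)
From mathcomp Require Import all_boot all_order all_algebra.
From mathcomp Require Import reals.

Set Implicit Arguments.
Unset Strict Implicit.
Unset Printing Implicit Defensive.

Import Order.TTheory GRing.Theory Num.Theory.
Local Open Scope ring_scope.

Definition sym_posdef (R : realType) (d : nat) (B : 'M[R]_d) : Prop :=
  B^T = B /\ forall x : 'cV[R]_d, x != 0 -> 0 < (x^T *m B *m x) 0 0.

(* <x, y>_B = <x, B^-1 y> *)
Definition dotB (R : realType) (d : nat) (B : 'M[R]_d) (x y : 'cV[R]_d) : R :=
  (x^T *m (invmx B *m y)) 0 0.

Definition normB (R : realType) (d : nat) (B : 'M[R]_d) (x : 'cV[R]_d) : R :=
  Num.sqrt (dotB B x x).

Record datum (R : realType) (d : nat) := Datum {
  pt : 'cV[R]_d;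
  fval : R;
  grad : 'cV[R]_d
}.

Definition Wgap (R : realType) (d : nat) (B : 'M[R]_d) (p q : datum R d) : R :=
  fval p - fval q - dotB B (grad q) (pt p - pt q).

Definition Qgap (R : realType) (d : nat) (B : 'M[R]_d) (L : R)
    (p q : datum R d) : R :=
  fval p - fval q - dotB B (grad q) (pt p - pt q)
    - 1 / (2 * L) * normB B (grad p - grad q) ^+ 2.

(* Histories are listed chronologically.  [finish] is the final response
   (x_star, f_star, g_star), made once the history is complete. *)
Record oracle (R : realType) (d : nat) := Oracle {
  respond : seq (datum R d) -> 'cV[R]_d -> R * 'cV[R]_d;
  finish : seq (datum R d) -> datum R d;
  finish_grad : forall h : seq (datum R d), grad (finish h) = 0
}.

(* D 0, ..., D N is the outcome of querying O at pt (D 0), ..., pt (D N);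
   the values of D beyond N are irrelevant. *)
Definition answered_by (R : realType) (d N : nat) (O : oracle R d)
    (D : nat -> datum R d) : Prop :=
  forall n : nat, (n <= N)%N ->
    (fval (D n), grad (D n)) = respond O (mkseq D n) (pt (D n)).

Definition final_response (R : realType) (d N : nat) (O : oracle R d)
    (D : nat -> datum R d) : datum R d :=
  finish O (mkseq D N.+1).

(* The class O_L, for N+1 queries followed by a final response: the
   inequalities hold whatever the query points are.  In Q_{i,j}, i < j, both
   indices are iteration indices; the star only occurs in W_{star,i}. *)
Definition oracle_class (R : realType) (d N : nat) (B : 'M[R]_d) (L : R)
    (O : oracle R d) : Prop :=
  forall D : nat -> datum R d, answered_by N O D ->
    (forall i j : nat, (i < j)%N -> (j <= N)%N -> 0 <= Qgap B L (D i) (D j)) /\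
    (forall i : nat, (i <= N)%N -> 0 <= Wgap B (final_response N O D) (D i)).

(* I_n = {max(0, n-k), ..., n-1} has minn n k elements; [widx] is its
   increasing enumeration (n - k is truncated). *)
Definition widx (k n : nat) (j : 'I_(minn n k)) : nat := (n - k + j)%N.

Definition vval (R : realType) (d : nat) (B : 'M[R]_d) (L : R)
    (p : datum R d) : R :=
  fval p - 1 / (2 * L) * normB B (grad p) ^+ 2.

Definition window_argmin (R : realType) (d k n : nat) (B : 'M[R]_d) (L : R)
    (D : nat -> datum R d) (m : 'I_(minn n k)) : Prop :=
  forall j : 'I_(minn n k), vval B L (D (widx m)) <= vval B L (D (widx j)).

Definition a_coef (R : realType) (d : nat) (B : 'M[R]_d) (L : R)
    (x0 : 'cV[R]_d) (D : nat -> datum R d) (tau : nat -> R)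
    (z : nat -> 'cV[R]_d) (m i : nat) : R :=
  tau i * (vval B L (D i) - vval B L (D m))
    + L / 2 * normB B (z i.+1 - x0) ^+ 2.

Definition b_coef (R : realType) (d : nat) (B : 'M[R]_d) (L : R)
    (x0 : 'cV[R]_d) (D : nat -> datum R d) (m i : nat) : R :=
  fval (D i) - dotB B (grad (D i)) (pt (D i) - x0) - vval B L (D m).

Definition Zmx (R : realType) (d k n : nat) (x0 : 'cV[R]_d)
    (z : nat -> 'cV[R]_d) : 'M[R]_(d, minn n k) :=
  \matrix_(r, j) (z (widx j).+1 - x0) r 0.

Definition Gmx (R : realType) (d k n : nat) (L : R) (D : nat -> datum R d) :
    'M[R]_(d, minn n k) :=
  \matrix_(r, j) (L^-1 *: grad (D (widx j))) r 0.

Definition objective (R : realType) (k n : nat) (tau : nat -> R)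
    (rho gamma : 'cV[R]_(minn n k)) : R :=
  \sum_j rho j 0 * tau (widx j) + \sum_j gamma j 0.

Definition feasible (R : realType) (d k n : nat) (B : 'M[R]_d) (L : R)
    (x0 : 'cV[R]_d) (D : nat -> datum R d) (tau : nat -> R)
    (z : nat -> 'cV[R]_d) (m : nat) (rho gamma : 'cV[R]_(minn n k)) : Prop :=
  [/\ 0 <= \sum_j rho j 0 * a_coef B L x0 D tau z m (widx j)
           + \sum_j gamma j 0 * b_coef B L x0 D m (widx j)
           - L / 2 * normB B (Zmx k n x0 z *m rho - Gmx k n L D *m gamma) ^+ 2,
      forall j, 0 <= rho j 0
    & forall j, 0 <= gamma j 0].

Definition optimal (R : realType) (d k n : nat) (B : 'M[R]_d) (L : R)
    (x0 : 'cV[R]_d) (D : nat -> datum R d) (tau : nat -> R)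
    (z : nat -> 'cV[R]_d) (m : nat) (rho gamma : 'cV[R]_(minn n k)) : Prop :=
  feasible B L x0 D tau z m rho gamma /\
  forall rho' gamma' : 'cV[R]_(minn n k),
    feasible B L x0 D tau z m rho' gamma' ->
    objective tau rho' gamma' <= objective tau rho gamma.

Definition tau_step (R : realType) (N i : nat) (t : R) : R :=
  if (i < N)%N then t + (1 + Num.sqrt (1 + 8 * t)) / 2 else t + Num.sqrt t.

(* Iteration n without early stop: the subproblem has an optimal solution, in
   particular it is bounded.  Ties in the argmin and among the optimal
   solutions may be broken arbitrarily. *)
Definition bspgm_step (R : realType) (d k N : nat) (B : 'M[R]_d) (L : R)
    (x0 : 'cV[R]_d) (D : nat -> datum R d) (tau : nat -> R)
    (z : nat -> 'cV[R]_d) (n : nat) : Prop :=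
  exists (m : 'I_(minn n k)) (rho gamma : 'cV[R]_(minn n k)),
    [/\ window_argmin B L D m,
        optimal B L x0 D tau z (widx m) rho gamma
      & let xm := D (widx m) in
        let tau' := objective tau rho gamma in
        let z' := x0 + Zmx k n x0 z *m rho - Gmx k n L D *m gamma in
        [/\ tau n = tau_step N n tau',
            pt (D n) = (tau' / tau n) *: (pt xm - L^-1 *: grad xm)
                       + ((tau n - tau') / tau n) *: z'
          & z n.+1 = z' - ((tau n - tau') / L) *: grad (D n)]].

(* A complete run (no early stop) of BSPGM with memory size k and L_0 = L
   against O.  The value z 0 is irrelevant. *)
Definition bspgm_run (R : realType) (d k N : nat) (B : 'M[R]_d) (L : R)
    (x0 : 'cV[R]_d) (O : oracle R d) (D : nat -> datum R d) (tau : nat -> R)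
    (z : nat -> 'cV[R]_d) : Prop :=
  [/\ answered_by N O D,
      pt (D 0%N) = x0,
      tau 0%N = 1,
      z 1%N = x0 - L^-1 *: grad (D 0%N)
    & forall n : nat, (1 <= n)%N -> (n <= N)%N ->
        bspgm_step k N B L x0 D tau z n].

(* tau_{n,i} for n <= i <= N (it is tau n when i <= n). *)
Fixpoint tau_ext (R : realType) (N : nat) (tau : nat -> R) (n i : nat) : R :=
  if i is i'.+1 then
    if (n <= i')%N then tau_step N i (tau_ext N tau n i') else tau n
  else tau n.

(* Main.v *)
(* Put v_i = f_i - |g_i|^2/(2L).  The run keeps the potential
     tau_i (f_* - v_i) + L/2 |x_0 - x_*|^2 - L/2 |z_{i+1} - x_*|^2
   nonnegative.  A feasible (rho, gamma) certifies the same inequality for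
   (tau', v_m, z'), by summing the potentials with weights rho and the W_{*,i}
   with weights gamma; adding tau' Q_{m,n} + (tau_n - tau') W_{*,n} gives it
   for (tau_n, v_n, z_{n+1}), the step size being the root that cancels the
   |g_n|^2 term.  The last step size cancels that term with f_N in place of
   v_N, which is the rate.  Finally tau' >= tau_{n-1}, and the step-size
   recursion is monotone, so the bounds improve along the run. *)
Require Import Defs.
From mathcomp Require Import all_boot all_order all_algebra.
From mathcomp Require Import reals.
From mathcomp Require Import ring lra zify.

Import Order.TTheory GRing.Theory Num.Theory.
Local Open Scope ring_scope.

(** * The inner product given by the inverse of a positive definite matrix *)

Section InnerProduct.
Context {R : realType} {d : nat} (B : 'M[R]_d).
Implicit Types (x y u : 'cV[R]_d) (c : R).

Lemma dotBDl x y u : dotB B (x + y) u = dotB B x u + dotB B y u.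
Proof. by rewrite /dotB linearD mulmxDl mxE. Qed.

Lemma dotBZl c x u : dotB B (c *: x) u = c * dotB B x u.
Proof. by rewrite /dotB linearZ -scalemxAl mxE. Qed.

Lemma dotBNl x u : dotB B (- x) u = - dotB B x u.
Proof. by rewrite -scaleN1r dotBZl mulN1r. Qed.

Lemma dotBDr x y u : dotB B u (x + y) = dotB B u x + dotB B u y.
Proof. by rewrite /dotB !mulmxDr mxE. Qed.

Lemma dotBZr c x u : dotB B u (c *: x) = c * dotB B u x.
Proof. by rewrite /dotB -!scalemxAr mxE. Qed.

Lemma dotBNr x u : dotB B u (- x) = - dotB B u x.
Proof. by rewrite -scaleN1r dotBZr mulN1r. Qed.

Definition dotBE := (dotBDl, dotBDr, dotBNl, dotBNr, dotBZl, dotBZr).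

Lemma dotB_mulmxl p (M : 'M[R]_(d, p)) (r : 'cV[R]_p) u :
  dotB B (M *m r) u = \sum_j r j 0 * dotB B (col j M) u.
Proof.
rewrite /dotB trmx_mul -mulmxA mxE; apply: eq_bigr => j _.
by rewrite mxE tr_col -row_mul [in RHS]mxE.
Qed.

Hypothesis Bpos : sym_posdef B.

(** A nonzero row of the kernel of [B] would be a nonzero vector on which the quadratic form
    vanishes. *)
Lemma posdef_unitmx : B \in unitmx.
Proof.
have [Bsym Bgt0] := Bpos.
rewrite -row_free_unit -kermx_eq0; apply/eqP/row_matrixP => i.
apply/eqP; rewrite row0; apply/negPn/negP => ker_neq0.
have /Bgt0 : (row i (kermx B))^T != 0 by rewrite trmx_eq0.
by rewrite trmxK -row_mul mulmx_ker row0 mul0mx mxE ltxx.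
Qed.

Lemma dotBC x y : dotB B x y = dotB B y x.
Proof.
have -> : dotB B x y = (x^T *m (invmx B *m y))^T 0 0 by rewrite mxE.
by rewrite !trmx_mul trmxK trmx_inv Bpos.1 -mulmxA.
Qed.

(** Substituting x = B y turns the form of the inverse at x into the form of [B] at y. *)
Lemma dotB_ge0 x : 0 <= dotB B x x.
Proof.
have [Bsym Bgt0] := Bpos.
set y := invmx B *m x.
have -> : dotB B x x = (y^T *m B *m y) 0 0.
  by rewrite /dotB -{1}(mulKVmx posdef_unitmx x) trmx_mul Bsym.
have [->|/Bgt0/ltW//] := eqVneq y 0.
by rewrite mulmx0 mxE.
Qed.

Lemma normB_sqr x : normB B x ^+ 2 = dotB B x x.
Proof. exact/sqr_sqrtr/dotB_ge0. Qed.

End InnerProduct.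

Lemma widx_lt (k n : nat) (j : 'I_(minn n k)) : (widx j < n)%N.
Proof. by rewrite /widx; have := ltn_ord j; lia. Qed.

(** * The potential and its propagation through one iteration *)

Section Potential.
Context {R : realType} {d : nat} (B : 'M[R]_d) (L : R) (x0 xs : 'cV[R]_d).
Variable fs : R.
Hypotheses (L_gt0 : 0 < L) (Bpos : sym_posdef B).

Let L_neq0 : L != 0. Proof. by rewrite gt_eqF. Qed.

(** The value [v] is free: it is v_i for ordinary iterates, v_m after aggregation and f_N at the
    end. *)
Definition potential (t v : R) (z : 'cV[R]_d) : R :=
  t * (fs - v) + L / 2 * normB B (x0 - xs) ^+ 2 - L / 2 * normB B (z - xs) ^+ 2.

Lemma potential_init (p : datum R d) : pt p = x0 ->
  potential 1 (vval B L p) (x0 - L^-1 *: grad p) = Wgap B (Datum xs fs 0) p.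
Proof.
move=> px0; rewrite /potential /vval /Wgap px0 /= !(normB_sqr _ Bpos) !dotBE.
by rewrite (dotBC _ Bpos xs x0) !(dotBC _ Bpos _ (grad p)); field.
Qed.

Lemma potential_aggregate k n (D : nat -> datum R d) (tau : nat -> R)
    (z : nat -> 'cV[R]_d) (m : nat) (rho gamma : 'cV[R]_(minn n k)) :
  (forall i, (i < n)%N -> 0 <= potential (tau i) (vval B L (D i)) (z i.+1)) ->
  (forall i, (i < n)%N -> 0 <= Wgap B (Datum xs fs 0) (D i)) ->
  feasible B L x0 D tau z m rho gamma ->
  0 <= potential (objective tau rho gamma) (vval B L (D m))
         (x0 + Zmx k n x0 z *m rho - Gmx k n L D *m gamma).
Proof.
move=> potge0 Wge0 [feas rho_ge0 gamma_ge0].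
set w := Zmx k n x0 z *m rho - Gmx k n L D *m gamma in feas *.
(* Each potential is recentred at [x0], so that [xs] enters only through fs and an inner product
   linear in z - x0. *)
have sum_rho : 0 <= \sum_j rho j 0 * (tau (widx j) * (fs - vval B L (D m))
    - a_coef B L x0 D tau z m (widx j)
    + L * dotB B (col j (Zmx k n x0 z)) (xs - x0)).
  apply: sumr_ge0 => j _; apply: mulr_ge0 => //.
  have := potge0 _ (widx_lt _ _ j); congr (0 <= _).
  have -> : col j (Zmx k n x0 z) = z (widx j).+1 - x0.
    by apply/matrixP => r s; rewrite !mxE ord1.
  rewrite /potential /a_coef !(normB_sqr _ Bpos) !dotBE.
  by rewrite (dotBC _ Bpos xs x0) !(dotBC _ Bpos (z _)); field.
have sum_gamma : 0 <= \sum_j gamma j 0 * (fs - vval B L (D m)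
    - b_coef B L x0 D m (widx j)
    - L * dotB B (col j (Gmx k n L D)) (xs - x0)).
  apply: sumr_ge0 => j _; apply: mulr_ge0 => //.
  have := Wge0 _ (widx_lt _ _ j); congr (0 <= _).
  have -> : col j (Gmx k n L D) = L^-1 *: grad (D (widx j)).
    by apply/matrixP => r s; rewrite !mxE ord1.
  by rewrite /Wgap /b_coef /= !dotBE; field.
(* Adding feasibility cancels the a and b sums and supplies the quadratic term of [w] that completes
   the square around [xs]. *)
have := addr_ge0 (addr_ge0 sum_rho sum_gamma) feas.
congr (0 <= _).
have -> : \sum_j rho j 0 * (tau (widx j) * (fs - vval B L (D m))
    - a_coef B L x0 D tau z m (widx j)
    + L * dotB B (col j (Zmx k n x0 z)) (xs - x0))
  = (\sum_j rho j 0 * tau (widx j)) * (fs - vval B L (D m))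
    - \sum_j rho j 0 * a_coef B L x0 D tau z m (widx j)
    + L * dotB B (Zmx k n x0 z *m rho) (xs - x0).
  rewrite dotB_mulmxl mulr_suml mulr_sumr -sumrB -big_split /=.
  by apply: eq_bigr => j _; ring.
have -> : \sum_j gamma j 0 * (fs - vval B L (D m)
    - b_coef B L x0 D m (widx j)
    - L * dotB B (col j (Gmx k n L D)) (xs - x0))
  = (\sum_j gamma j 0) * (fs - vval B L (D m))
    - \sum_j gamma j 0 * b_coef B L x0 D m (widx j)
    - L * dotB B (Gmx k n L D *m gamma) (xs - x0).
  rewrite dotB_mulmxl mulr_suml mulr_sumr -!sumrB /=.
  by apply: eq_bigr => j _; ring.
rewrite /potential /objective -[x0 + _ - _]addrA -/w.
have -> : L * dotB B (Gmx k n L D *m gamma) (xs - x0)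
    = L * dotB B (Zmx k n x0 z *m rho) (xs - x0) - L * dotB B w (xs - x0).
  by rewrite /w [dotB B (_ - _) _]dotBDl dotBNl; ring.
(* Making [w] opaque keeps [dotBE] from expanding it. *)
rewrite !(normB_sqr _ Bpos); move: {feas} w => w; rewrite !dotBE.
by rewrite !(dotBC _ Bpos _ w) (dotBC _ Bpos xs x0); field.
Qed.

(* The two weights [s] used are 1, for an intermediate step (potential at
   [vval]), and 0, for the last one (potential at [fval]). *)
Lemma potential_step (s t t' : R) (p q : datum R d) (z' : 'cV[R]_d) :
  0 <= t' -> t' <= t -> 0 < t -> (t - t') ^+ 2 = t' + s * t ->
  0 <= potential t' (vval B L p) z' ->
  0 <= Qgap B L p q -> 0 <= Wgap B (Datum xs fs 0) q ->
  pt q = (t' / t) *: (pt p - L^-1 *: grad p) + ((t - t') / t) *: z' ->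
  0 <= potential t (fval q - s / (2 * L) * normB B (grad q) ^+ 2)
         (z' - ((t - t') / L) *: grad q).
Proof.
move=> t'_ge0 t't t_gt0 st pot Qge0 Wge0 ptq.
have t_neq0 : t != 0 by rewrite gt_eqF.
have dt_ge0 : 0 <= t - t' by rewrite subr_ge0.
have := addr_ge0 pot (addr_ge0 (mulr_ge0 t'_ge0 Qge0) (mulr_ge0 dt_ge0 Wge0)).
congr (0 <= _); apply/eqP; rewrite -subr_eq0; apply/eqP.
(* Once [pt q] is substituted, all other terms cancel and only the square of [grad q] is left, with
   a coefficient that [st] makes zero. *)
transitivity
  (((t - t') ^+ 2 - (t' + s * t)) / (2 * L) * dotB B (grad q) (grad q)).
  rewrite /potential /vval /Qgap /Wgap ptq /= !(normB_sqr _ Bpos) !dotBE.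
  rewrite !(dotBC _ Bpos _ (grad q)) (dotBC _ Bpos xs x0) (dotBC _ Bpos xs z').
  by field; rewrite L_neq0.
by rewrite st subrr !mul0r.
Qed.

End Potential.

(** * Step-size recursion: monotonicity and closed form *)

Section StepSize.
Context {R : realType} (N : nat).

Lemma tau_step_gt (i : nat) (t : R) : 0 < t -> t < tau_step N i t.
Proof.
move=> t_gt0; rewrite /tau_step; case: ifP => _; rewrite ltrDl ?sqrtr_gt0//.
by rewrite divr_gt0// ltr_pwDl// sqrtr_ge0.
Qed.

Lemma tau_step_le (i : nat) (t u : R) :
  0 <= t -> t <= u -> tau_step N i t <= tau_step N i u.
Proof.
move=> t_ge0 tu; rewrite /tau_step; case: ifP => _; apply: lerD => //.
  by rewrite ler_pM2r ?invr_gt0// lerD2l ler_sqrt; lra.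
by rewrite ler_sqrt; lra.
Qed.

(** The quadratic equation behind each step size; the indicator of i < N is the weight [s] of
    [potential_step]. *)
Lemma tau_step_sqr (i : nat) (t : R) : 0 <= t ->
  (tau_step N i t - t) ^+ 2 = t + (i < N)%:R * tau_step N i t.
Proof.
move=> t_ge0; rewrite /tau_step; case: ifP => _; rewrite (addrC t) addrK.
  set r := Num.sqrt _; have r2 : r ^+ 2 = 1 + 8 * t by rewrite sqr_sqrtr; lra.
  have -> : t = (r ^+ 2 - 1) / 8 by rewrite r2; field.
  by rewrite mulr1n; field.
by rewrite sqr_sqrtr// mul0r addr0.
Qed.

Lemma tau_ext_id (tau : nat -> R) (n : nat) : tau_ext N tau n n = tau n.
Proof. by case: n => //= n; rewrite ltnn. Qed.

(** From index n+1 on, both sequences obey the same monotone recursion, so the order of their values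
    there persists. Positivity is carried along because monotonicity of the step requires it. *)
Lemma tau_ext_le (tau : nat -> R) (n i : nat) :
  0 < tau n -> tau_step N n.+1 (tau n) <= tau n.+1 -> (n < i)%N ->
  0 < tau_ext N tau n i <= tau_ext N tau n.+1 i.
Proof.
move=> tau_gt0 step_le; elim: i => // i IHi; rewrite ltnS leq_eqVlt.
case/predU1P => [<-|ni].
  rewrite tau_ext_id /= leqnn tau_ext_id step_le andbT.
  exact: lt_trans (tau_step_gt _ _ _).
have /andP[ext_gt0 ext_le] := IHi ni; rewrite /= (ltnW ni) ni.
by rewrite (lt_trans ext_gt0 (tau_step_gt _ _ _))// tau_step_le// ltW.
Qed.

(** These are the triangular numbers: 1 + 8t is a perfect square at each of them, so the root is
    exact. *)
Lemma tau_ext0 (tau : nat -> R) (i : nat) : tau 0%N = 1 -> (i < N)%N ->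
  tau_ext N tau 0 i = (i%:R + 1) * (i%:R + 2) / 2.
Proof.
move=> tau0; elim: i => [|i IHi] iN; first by rewrite /= tau0; field.
rewrite /= IHi 1?ltnW// /tau_step iN.
have i_ge0 : 0 <= i%:R :> R by rewrite ler0n.
have -> : 1 + 8 * ((i%:R + 1) * (i%:R + 2) / 2) = (2 * i%:R + 3) ^+ 2 :> R.
  by field.
by rewrite sqrtr_sqr ger0_norm ?(natrS _ i) -?natr1; [field|lra].
Qed.

Lemma tau_ext0_last (tau : nat -> R) : tau 0%N = 1 -> (1 <= N)%N ->
  1 / tau_ext N tau 0 N
    = 2 / (N%:R * (N%:R + 1) + Num.sqrt (2 * N%:R * (N%:R + 1))).
Proof.
move=> tau0 N_gt0.
have N_ge1 : 1 <= N%:R :> R by rewrite ler1n.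
(* The closed form at index N-1, just before the final step. *)
have -> : tau_ext N tau 0 N = tau_step N N (N%:R * (N%:R + 1) / 2).
  rewrite -{2 3}(prednK N_gt0) /= prednK// tau_ext0 ?prednK//.
  by rewrite -subn1 natrB//; congr (tau_step _ _ _); field.
rewrite /tau_step ltnn.
set u := N%:R * (N%:R + 1) / 2.
have u_gt0 : 0 < u by rewrite /u divr_gt0 ?mulr_gt0; lra.
have -> : 2 * N%:R * (N%:R + 1) = 2 ^+ 2 * u by rewrite /u; field.
rewrite (sqrtrM _ (sqr_ge0 2)) sqrtr_sqr ger0_norm//.
have -> : N%:R * (N%:R + 1) = 2 * u by rewrite /u; field.
have den_gt0 : 0 < u + Num.sqrt u by rewrite ltr_wpDr// sqrtr_ge0.
by field; rewrite -mulrDr !gt_eqF// mulr_gt0.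
Qed.

End StepSize.

(** * Invariants along a run *)

Section Run.
Context {R : realType} {d : nat} (N k : nat) (B : 'M[R]_d) (L : R).
Context (x0 : 'cV[R]_d) (D : nat -> datum R d) (tau : nat -> R).
Context (z : nat -> 'cV[R]_d).
Hypothesis k_gt0 : (1 <= k)%N.

(* Weight 1 on the last entry of [rho] and 0 elsewhere is feasible. *)
Lemma tau_le_objective (n : nat) (m : 'I_(minn n.+1 k))
    (rho gamma : 'cV[R]_(minn n.+1 k)) :
  0 <= tau n -> window_argmin B L D m ->
  optimal B L x0 D tau z (widx m) rho gamma ->
  tau n <= objective tau rho gamma.
Proof.
move=> tau_ge0 argmin [_ opt].
(* The window is nonempty because k is at least 1, and its last entry is iterate n. *)
have last_lt : ((minn n.+1 k).-1 < minn n.+1 k)%N by lia.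
pose l := Ordinal last_lt.
have lE : widx l = n by rewrite /widx /=; lia.
have sum_delta (F : 'I_(minn n.+1 k) -> R) :
    \sum_j (delta_mx l 0 : 'cV[R]__) j 0 * F j = F l.
  rewrite (bigD1 l)//= mxE !eqxx mul1r big1 ?addr0// => j jl.
  by rewrite mxE (negPf jl) mul0r.
suff /opt : feasible B L x0 D tau z (widx m) (delta_mx l 0) 0.
  by rewrite /objective sum_delta lE big1 ?addr0// => j _; rewrite mxE.
split=> [|j|j]; rewrite ?mxE ?ler0n//.
rewrite sum_delta big1 => [|j _]; last by rewrite mxE mul0r.
rewrite mulmx0 subr0 addr0 -colE.
have -> : col l (Zmx k n.+1 x0 z) = z n.+1 - x0 :> 'cV_d.
  by apply/matrixP => r s; rewrite !mxE ord1 lE.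
(* The norms cancel, leaving tau_n (v_n - v_m), nonnegative by the choice of m. *)
by rewrite /a_coef lE addrK mulr_ge0// subr_ge0; have := argmin l; rewrite lE.
Qed.

Lemma tau_step_le_run (n : nat) : 0 <= tau n ->
  bspgm_step k N B L x0 D tau z n.+1 -> tau_step N n.+1 (tau n) <= tau n.+1.
Proof.
move=> tau_ge0 [m [rho [gamma [argmin opt [-> _ _]]]]].
apply: tau_step_le => //.
exact: (tau_le_objective _ _ _ _ tau_ge0 argmin opt).
Qed.

Hypothesis tau0 : tau 0%N = 1.
Hypothesis step : forall n : nat, (1 <= n)%N -> (n <= N)%N ->
  bspgm_step k N B L x0 D tau z n.

Lemma tau_run_gt0 (n : nat) : (n <= N)%N -> 0 < tau n.
Proof.
elim: n => [|n IHn] nN; first by rewrite tau0.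
have tau_gt0 := IHn (ltnW nN); apply: (lt_trans tau_gt0).
apply: (lt_le_trans (tau_step_gt N n.+1 _ tau_gt0)).
exact: (tau_step_le_run _ (ltW tau_gt0) (step n.+1 isT nN)).
Qed.

Lemma potential_run_ge0 (xs : 'cV[R]_d) (fs : R) :
  0 < L -> sym_posdef B -> (1 <= N)%N ->
  pt (D 0%N) = x0 -> z 1%N = x0 - L^-1 *: grad (D 0%N) ->
  (forall i j : nat, (i < j)%N -> (j <= N)%N -> 0 <= Qgap B L (D i) (D j)) ->
  (forall i : nat, (i <= N)%N -> 0 <= Wgap B (Datum xs fs 0) (D i)) ->
  forall n : nat, (n <= N)%N ->
  0 <= potential B L x0 xs fs (tau n)
    (fval (D n) - (n < N)%:R / (2 * L) * normB B (grad (D n)) ^+ 2) (z n.+1).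
Proof.
(* Strong induction, since the window reaches back over several iterates. *)
move=> L_gt0 Bpos N_gt0 pt0 z1 Qge0 Wge0; elim/ltn_ind => -[_ _|n IHn nN].
  rewrite N_gt0 tau0 z1 -/(vval B L (D 0%N)) potential_init//.
  exact: Wge0.
have [m [rho [gamma [argmin opt]]]] := step n.+1 isT nN.
set t' := objective tau rho gamma; set z' := _ - _ => -[tauE ptE ->].
have tau_gt0 := tau_run_gt0 _ (ltnW nN).
have t'_gt0 : 0 < t'.
  apply: (lt_le_trans tau_gt0).
  exact: (tau_le_objective _ _ _ _ (ltW tau_gt0) argmin opt).
apply: (@potential_step R d B L x0 xs fs L_gt0 Bpos _ (tau n.+1) t'
  (D (widx m))) => //.
- exact: ltW.
- by rewrite tauE ltW// tau_step_gt.
- exact: tau_run_gt0.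
- by rewrite tauE tau_step_sqr// ltW.
(* Earlier indices lie below N, so their indicator is 1 and the hypothesis is about v_i. *)
- apply: potential_aggregate opt.1 => // i iS.
    have := IHn i iS (ltnW (leq_trans iS nN)).
    by rewrite (leq_trans iS nN).
  exact/Wge0/(leq_trans (ltnW iS)).
- by apply: Qge0 => //; exact: widx_lt.
- exact: Wge0.
Qed.

End Run.

Theorem theorem3p3 (R : realType) (d N k : nat) (L : R) (B : 'M[R]_d)
    (x0 : 'cV[R]_d) (O : oracle R d) (D : nat -> datum R d) (tau : nat -> R)
    (z : nat -> 'cV[R]_d) (xstar : 'cV[R]_d) (fstar : R) :
  0 < L -> (1 <= N)%N -> (1 <= k)%N -> sym_posdef B ->
  oracle_class N B L O ->
  bspgm_run k N B L x0 O D tau z ->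
  final_response N O D = Datum xstar fstar 0 ->
  [/\ (fval (D N) - fstar) / (L / 2 * normB B (x0 - xstar) ^+ 2)
        <= 1 / tau_ext N tau N N,
      forall n : nat, (n < N)%N ->
        1 / tau_ext N tau n.+1 N <= 1 / tau_ext N tau n N
    & 1 / tau_ext N tau 0 N
        = 2 / (N%:R * (N%:R + 1)
               + Num.sqrt (2 * N%:R * (N%:R + 1)))].
Proof.
move=> L_gt0 N_gt0 k_gt0 Bpos OL [answered pt0 tau0 z1 step] finalE.
have [Qge0 Wge0] := OL D answered; rewrite finalE in Wge0.
have tau_gt0 := @tau_run_gt0 _ _ _ _ _ _ _ _ _ _ k_gt0 tau0 step.
split=> [|n nN|]; last exact: tau_ext0_last.
- have := @potential_run_ge0 _ _ _ _ _ _ _ _ _ _ k_gt0 tau0 step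
    _ _ L_gt0 Bpos N_gt0 pt0 z1 Qge0 Wge0 N (leqnn N).
  rewrite ltnn !mul0r subr0 /potential tau_ext_id => pot_ge0.
  have tauN := tau_gt0 N (leqnn N).
  set r := L / 2 * normB B (x0 - xstar) ^+ 2 in pot_ge0 *.
  (* This term enters the potential negatively and is dropped to obtain the rate. *)
  have zge0 : 0 <= L / 2 * normB B (z N.+1 - xstar) ^+ 2.
    by rewrite mulr_ge0 ?sqr_ge0// divr_ge0// ltW.
  have r_ge0 := mulr_ge0 (ltW L_gt0) (sqr_ge0 (normB B (x0 - xstar))).
  (* If [r] is zero, division by zero makes the left-hand side 0. *)
  have [r0|r_neq0] := eqVneq r 0.
    by rewrite r0 invr0 mulr0 divr_ge0// ltW.
  have r_gt0 : 0 < r by rewrite lt_neqAle eq_sym r_neq0 /= /r; lra.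
  by rewrite ler_pdivrMr// mulrAC ler_pdivlMr// mul1r; lra.
- have tau_n := tau_gt0 n (ltnW nN).
  have step_le : tau_step N n.+1 (tau n) <= tau n.+1.
    exact: (tau_step_le_run _ _ _ _ _ _ _ _ k_gt0 n (ltW tau_n)
      (step n.+1 isT nN)).
  have /andP[ext_gt0 ext_le] := tau_ext_le N tau n N tau_n step_le nN.
  by rewrite !div1r lef_pV2// posrE// (lt_le_trans ext_gt0).
Qed.
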